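(* For each $i\in\{1,\,1\tfrac12,\,2,\,2\tfrac12,\,3\}$, existence of a DC$i$ pair does not imply existence of an infinite DC$i$ set for continuous self-maps of dendrites; that is, for each such $i$ there exist a dendrite $X$ and a continuous map $f:X\to X$ such that $f$ has a DC$i$ pair but has no infinite DC$i$ set.
   Context: A dendrite is a locally connected continuum (compact connected metric space) containing no subset homeomorphic to the circle. Let $(X,d)$ be a compact metric space and $f:X\to X$ continuous. For $x,y\in X$ and $\delta>0$ put $$\Phi_{(f,x,y)}(\delta)=\liminf_{n\to\infty}\frac1n\#\{0\le k\le n: d(f^k(x),f^k(y))<\delta\},\qquad \Phi^*_{(f,x,y)}(\delta)=\limsup_{n\to\infty}\frac1n\#\{0\le k\le n: d(f^k(x),f^k(y))<\delta\},$$ and $\Phi_{(f,x,y)}(0)=\lim_{\delta\to0^+}\Phi_{(f,x,y)}(\delta)$, $\Phi^*_{(f,x,y)}(0)=\lim_{\delta\to0^+}\Phi^*_{(f,x,y)}(\delta)$. A pair $(x,y)\in X^2$ is: - a DC1 pair if $\Phi^*_{(f,x,y)}(\delta)=1$ for every $0<\delta\le \operatorname{diam}X$ and $\Phi_{(f,x,y)}(\epsilon)=0$ for some $0<\epsilon\le\operatorname{diam}X$; - a DC$1\frac12$ pair if $\Phi^*_{(f,x,y)}(\delta)=1$ for every $0<\delta\le \operatorname{diam}X$ and $\Phi_{(f,x,y)}(0)=0$; - a DC2 pair if $\Phi^*_{(f,x,y)}(\delta)=1$ for every $0<\delta\le \operatorname{diam}X$ and $\Phi_{(f,x,y)}(\epsilon)<1$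 for some $0<\epsilon\le\operatorname{diam}X$; - a DC$2\frac12$ pair if $\Phi_{(f,x,y)}(0)<\Phi^*_{(f,x,y)}(0)$; - a DC3 pair if there are $0\le a<b\le\operatorname{diam}X$ such that $\Phi_{(f,x,y)}(\delta)<\Phi^*_{(f,x,y)}(\delta)$ for every $\delta\in(a,b)$. A set $S\subset X$ is a DC$i$ set if every pair of distinct points of $S$ is a DC$i$ pair. *)

(* Defs.v *)
From mathcomp Require Import all_boot all_order all_algebra.
From mathcomp Require Import all_classical all_reals all_analysis.

Set Implicit Arguments.
Unset Strict Implicit.
Unset Printing Implicit Defensive.

Import Order.TTheory GRing.Theory Num.Theory.
Import numFieldNormedType.Exports.

Local Open Scope classical_set_scope.
Local Open Scope ring_scope.

Definition homeomorphic (T U : topologicalType) : Prop :=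
  exists (g : T -> U) (h : U -> T),
    [/\ cancel g h, cancel h g, continuous g & continuous h].

Definition locally_connected (T : topologicalType) : Prop :=
  forall (x : T) (U : set T), nbhs x U ->
    exists V : set T, [/\ open V, connected V, V x & V `<=` U].

Definition circle (R : realType) : set (R * R)%type :=
  [set p : R * R | p.1 ^+ 2 + p.2 ^+ 2 = 1].
Arguments circle : clear implicits.

(* [A] and [circle R] are coerced to their [set_type], which carries the
   topology induced by the inclusion. *)
Definition dendrite (R : realType) (X : metricType R) : Prop :=
  [/\ compact [set: X],
      connected [set: X],
      locally_connected X
    & ~ exists A : set X, homeomorphic A (circle R)].

Definition diam (R : realType) (X : metricType R) : R :=
  sup [set mdist p.1 p.2 | p in [set: X * X]].

Section distributional_functions.
Context {R : realType} {X : metricType R}.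
Variables (f : X -> X) (x y : X).

(* The count ranges over the n + 1 times 0 <= k <= n but is divided by n; the
   junk value 0 at n = 0 does not affect the limits. *)
Definition close_freq (delta : R) (n : nat) : R :=
  n%:R^-1 *
  #|[pred k : 'I_n.+1 | mdist (iter k f x) (iter k f y) < delta]|%:R.

(* [close_freq delta] takes its values in [0, 2], so that the lower and upper
   limits are genuine; they are nondecreasing in [delta], so that the right
   limits at 0 exist. *)
Definition Phi (delta : R) : R := limn_inf (close_freq delta).

Definition Phi_star (delta : R) : R := limn_sup (close_freq delta).

Definition Phi0 : R := lim (Phi delta @[delta --> 0^'+]).

Definition Phi_star0 : R := lim (Phi_star delta @[delta --> 0^'+]).

End distributional_functions.

(* The index i of DCi, in the order 1, 1 1/2, 2, 2 1/2, 3. *)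
Inductive dc_index := dc_1 | dc_1half | dc_2 | dc_2half | dc_3.

Definition DC_pair (R : realType) (X : metricType R) (i : dc_index)
    (f : X -> X) (x y : X) : Prop :=
  match i with
  | dc_1 =>
      (forall delta, 0 < delta <= diam X -> Phi_star f x y delta = 1) /\
      (exists2 eps, 0 < eps <= diam X & Phi f x y eps = 0)
  | dc_1half =>
      (forall delta, 0 < delta <= diam X -> Phi_star f x y delta = 1) /\
      Phi0 f x y = 0
  | dc_2 =>
      (forall delta, 0 < delta <= diam X -> Phi_star f x y delta = 1) /\
      (exists2 eps, 0 < eps <= diam X & Phi f x y eps < 1)
  | dc_2half =>
      Phi0 f x y < Phi_star0 f x y
  | dc_3 =>
      exists a b : R, [/\ 0 <= a, a < b, b <= diam X
        & forall delta, a < delta < b ->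
            Phi f x y delta < Phi_star f x y delta]
  end.

Definition DC_set (R : realType) (X : metricType R) (i : dc_index)
    (f : X -> X) (S : set X) : Prop :=
  forall x y : X, S x -> S y -> x <> y -> DC_pair i f x y.

(* Main.v *)
From HB Require Import structures.
From mathcomp Require Import all_boot all_order all_algebra.
From mathcomp Require Import all_classical all_reals all_analysis.
From mathcomp Require Import ring lra.
Require Import Defs.

(** One map serves every index.  The space is a comb: a base segment with teeth
    of heights [h n] tending to 0, planted at pairwise distinct feet [b n] with
    [|b (n+1) - b n| <= h n].  The map fixes the base, sends the lower half
    of the [n]-th tooth affinely onto the base segment from [b n] to [b (n+1)],
    and its upper half affinely onto the [(n+1)]-st tooth.  The feet move
    slowly, so the map is Lipschitz ([shift_dist]); it sends the tip of a tooth
    to the tip of the next one, and doubles the relative distance to the tip on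
    the upper half.  Hence every point that is not a tip falls on the base in
    finite time and stops there ([fate]).

    Two points that come to rest are at a constant distance from some time on;
    two tips are asymptotic, because they follow the same slowly moving feet
    ([tips_asymptotic]).  In both cases the lower and the upper distribution
    functions agree at every positive distance, which excludes all five kinds
    of pairs ([not_DC_pair]).  So a DC set contains at most one tip and at most
    one point that comes to rest.

    A tip and the end [0] of the base form a pair of every kind as soon as the
    feet stay near [0] on time windows [[m, n]] with [n / m] arbitrarily large,
    and stay away from [0] on other such windows ([DC_pair_of_runs]).  The feet
    follow the sequence [wander], which moves by at most [2 / (n+1)] and changes
    direction only at the times [2 ^ 2 ^ j]: it needs the time from [N] to [2 N]
    to cross the unit interval, and then waits at its end until time [N ^ 2].
    A perturbation [lam / (n+1)] makes the feet distinct; all but countably many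
    values of [lam] will do ([foot_injective]).

    The comb is a dendrite.  It contains no circle since a nonconstant
    continuous real function on a circle takes each intermediate value at least
    twice ([circle_level_two]), whereas the first coordinate of the comb takes
    each value that is not a foot exactly once. *)

Set Implicit Arguments.
Unset Strict Implicit.
Unset Printing Implicit Defensive.

Import Order.TTheory GRing.Theory Num.Theory.
Import numFieldNormedType.Exports.

Local Open Scope classical_set_scope.
Local Open Scope ring_scope.

(** * Level sets of real functions on a circle *)

(** Used both to find a level that meets no tooth and to choose the
    perturbation that separates the feet. *)
Lemma uncountable_gap (R : realType) (A : set R) (a b : R) :
  countable A -> a < b -> exists2 v, a < v < b & ~ A v.
Proof.
move=> cA ab; apply: contrapT => noV.
have sub : `]a, b[%classic `<=` A.
  move=> v /=; rewrite in_itv /= => avb; apply: contrapT => nAv.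
  by apply: noV; exists v.
have /countable_lebesgue_measure0 : countable `]a, b[%classic.
  exact: sub_countable (subset_card_le sub) cA.
rewrite lebesgue_measure_itv /= lte_fin ab => -[] /eqP.
by rewrite subr_eq0 gt_eqF.
Qed.

Section circle.
Context {R : realType}.
Implicit Types p q : circle R.

(** The inverse of the stereographic projection, rotated (that is, multiplied
    by [p] as a complex number) so that it parametrizes the circle without
    [p]. *)
Definition punctured_curve (p : R * R) (t : R) : R * R :=
  let d := (t ^+ 2 + 1)^-1 in
  ((p.1 * (t ^+ 2 - 1) - p.2 * (2 * t)) * d,
   (p.1 * (2 * t) + p.2 * (t ^+ 2 - 1)) * d).

Let den_neq0 (t : R) : t ^+ 2 + 1 != 0.
Proof. by rewrite gt_eqF // ltr_wpDl ?sqr_ge0. Qed.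

Lemma punctured_curve_circle p t : circle R (punctured_curve (val p) t).
Proof.
have := set_valP p; rewrite /circle /= => cp.
rewrite !exprMn -mulrDl.
have -> : forall x y u v : R,
  (x * u - y * v) ^+ 2 + (x * v + y * u) ^+ 2 =
  (x ^+ 2 + y ^+ 2) * (u ^+ 2 + v ^+ 2) by move=> *; ring.
by rewrite cp; field.
Qed.

Definition punctured p t : circle R :=
  exist _ (punctured_curve (val p) t) (mem_set (punctured_curve_circle p t)).

Lemma punctured_neq p t : punctured p t <> p.
Proof.
move=> /(congr1 val) /=; have := set_valP p; rewrite /circle /=.
case: (val p) => x y /= cp [] /(canRL (mulfVK (den_neq0 t))) e1.
move=> /(canRL (mulfVK (den_neq0 t))) e2.
have /eqP : 2 * (x ^+ 2 + y ^+ 2) = 0 by nra.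
by rewrite cp mulr1 pnatr_eq0.
Qed.

Lemma punctured_surj p q : q <> p -> exists t, punctured p t = q.
Proof.
move=> qp; have := set_valP p; have := set_valP q.
rewrite /circle /=.
case ep : (val p) => [x y]; case eq : (val q) => [u v] /= cq cp.
pose C := u * x + v * y; pose S := v * x - u * y.
have CS : C ^+ 2 + S ^+ 2 = 1.
  by rewrite -[1]mulr1 -{1}cp -cq /C /S; ring.
have C1 : 1 - C != 0.
  apply/eqP => C1; apply: qp; apply: val_inj; rewrite ep eq.
  have : (u - x) ^+ 2 + (v - y) ^+ 2 = 0 by rewrite /C in C1; nra.
  move=> /eqP; rewrite paddr_eq0 ?sqr_ge0 // !sqrf_eq0 !subr_eq0.
  by move=> /andP[/eqP -> /eqP ->].
(* C + iS is q times the conjugate of p, so that the parameter of q is the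
   stereographic projection of C + iS *)
exists (S / (1 - C)); apply: val_inj; rewrite /= ep eq /punctured_curve /=.
have den : (S / (1 - C)) ^+ 2 + 1 = 2 / (1 - C).
  rewrite exprMn (_ : S ^+ 2 = (1 - C) * (1 + C)); last by nra.
  by field.
have num : (S / (1 - C)) ^+ 2 - 1 = 2 * C / (1 - C).
  rewrite exprMn (_ : S ^+ 2 = (1 - C) * (1 + C)); last by nra.
  by field.
have cp1 : y ^+ 2 = 1 - x ^+ 2 by rewrite -cp; ring.
rewrite den num; congr pair.
- transitivity (x * C - y * S); first by field.
  transitivity (u * (x ^+ 2 + y ^+ 2)); first by rewrite /C /S; ring.
  by rewrite cp mulr1.
- transitivity (x * S + y * C); first by field.
  transitivity (v * (x ^+ 2 + y ^+ 2)); first by rewrite /C /S; ring.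
  by rewrite cp mulr1.
Qed.

Lemma punctured_continuous p : continuous (punctured p).
Proof.
apply: continuous_comp_initial => /=.
rewrite (_ : _ \o _ = punctured_curve (val p)) //.
move=> t; have dc : {for t, continuous (fun t : R => (t ^+ 2 + 1)^-1)}.
  apply: continuousV; first exact: den_neq0.
  by apply: continuousD; [exact: exprn_continuous|exact: cst_continuous].
have tc : {for t, continuous (fun t : R => 2 * t)}.
  exact: mulrl_continuous.
have sc : {for t, continuous (fun t : R => t ^+ 2 - 1)}.
  by apply: continuousD; [exact: exprn_continuous|exact: cst_continuous].
have cM (c : R) (u : R -> R) : {for t, continuous u} ->
    {for t, continuous (fun t => c * u t)}.
  by move=> cu; apply: continuousM; [exact: cst_continuous|exact: cu].
have h1 : {for t, continuous (fun t => (punctured_curve (val p) t).1)}.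
  by apply: (continuousM _ dc); apply: continuousB; exact: cM.
have h2 : {for t, continuous (fun t => (punctured_curve (val p) t).2)}.
  by apply: (continuousM _ dc); apply: continuousD; exact: cM.
exact: (cvg_pair h1 h2).
Qed.

(** The circle without [c] is a curve, to which the intermediate value theorem
    applies. *)
Lemma circle_level_avoiding (phi : circle R -> R) (c a b : circle R) v :
    continuous phi -> a <> c -> b <> c -> phi a < v < phi b ->
  exists2 d, d <> c & phi d = v.
Proof.
move=> cphi /punctured_surj [s sa] /punctured_surj [t tb] avb.
have cg : continuous (phi \o punctured c).
  by move=> u; apply: continuous_comp; [exact: punctured_continuous|exact: cphi].
have mm (x y : R) : x < v < y ->
    (Num.min x y <= v <= Num.max x y) && (Num.min y x <= v <= Num.max y x).
  by move=> /andP[xv vy]; rewrite !ge_min !le_max !(ltW xv) !(ltW vy) ?orbT.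
have /andP[m1 m2] := mm _ _ avb.
have [st|/ltW ts] := leP s t.
- have [||u _ uv] := @IVT R (phi \o punctured c) s t v st.
  + exact: continuous_subspaceT.
  + by rewrite /= sa tb.
  by exists (punctured c u) => //; exact: punctured_neq.
- have [||u _ uv] := @IVT R (phi \o punctured c) t s v ts.
  + exact: continuous_subspaceT.
  + by rewrite /= sa tb.
  by exists (punctured c u) => //; exact: punctured_neq.
Qed.

Lemma circle_two_points : exists p q : circle R, p <> q.
Proof.
have c1 : circle R (1, 0) by rewrite /circle /= expr1n expr0n addr0.
pose p : circle R := exist _ (1, 0) (mem_set c1).
by exists (punctured p 0), p; exact: punctured_neq.
Qed.

Lemma circle_third_point (a b : circle R) : exists2 c, a <> c & b <> c.
Proof.
have [b0|b0] := pselect (b = punctured a 0); last first.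
  by exists (punctured a 0) => //; exact/nesym/punctured_neq.
exists (punctured a 1); first exact/nesym/punctured_neq.
rewrite b0 => /(congr1 val) /=; have := set_valP a; rewrite /circle /=.
case: (val a) => x y /= ca [].
rewrite !expr1n expr0n /= !subrr !sub0r !mulr0 !subr0 !addr0 !add0r !mulr1.
rewrite invr1 !mulr1 -[1 + 1]/(2 : R) => e1 e2; clear b0 b a.
have x0 : x = 0 by lra.
by move: ca; rewrite (_ : y = 0) ?x0 ?expr0n /= ?addr0; lra.
Qed.

(** Removing a first point of the level [v] leaves a curve from [a] to [b],
    which must cross the level again. *)
Lemma circle_level_two (phi : circle R -> R) (a b : circle R) v :
    continuous phi -> phi a < v < phi b ->
  exists c d, [/\ c <> d, phi c = v & phi d = v].
Proof.
move=> cphi /[dup] avb /andP[av vb].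
have [p ap bp] := circle_third_point a b.
have [c _ phic] := circle_level_avoiding cphi ap bp avb.
have [||d dc dv] := @circle_level_avoiding phi c a b v cphi _ _ avb.
- by move=> ac; move: av; rewrite ac phic ltxx.
- by move=> bc; move: vb; rewrite bc phic ltxx.
by exists c, d; split => //; exact: nesym.
Qed.

End circle.

(** * The comb and its barbed-wire metric *)

Section barb.
Context {R : realType}.
Implicit Types z w : R * R.

(** The length of the shortest path from [z] to [w] when all vertical lines are
    connected through the horizontal axis only.  With this metric the balls of
    the comb are connected and the map below is Lipschitz.  For the Euclidean
    metric a ball around the upper part of a tooth can meet neighbouring teeth,
    and neither property need hold. *)
Definition barb z w : R :=
  `|z.1 - w.1| + (if z.1 == w.1 then `|z.2 - w.2| else `|z.2| + `|w.2|).

Lemma barbxx z : barb z z = 0.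
Proof. by rewrite /barb eqxx !subrr normr0 addr0. Qed.

Lemma barb_positivity z w : barb z w = 0 -> z = w.
Proof.
rewrite /barb; case: z w => [t s] [t' s'] /=.
have := normr_ge0 (t - t').
case: eqP => [->|/eqP tt'] _.
  rewrite subrr normr0 add0r => /normr0_eq0 /eqP.
  by rewrite subr_eq0 => /eqP ->.
have : 0 < `|t - t'| by rewrite normr_gt0 subr_eq0.
by have := normr_ge0 s; have := normr_ge0 s' => *; exfalso; lra.
Qed.

Lemma barb_sym z w : barb z w = barb w z.
Proof. by rewrite /barb distrC eq_sym (distrC z.2) (addrC `|z.2|). Qed.

Lemma barb_triangle y x z : barb x z <= barb x y + barb y z.
Proof.
case: x y z => [t s] [t' s'] [t'' s'']; rewrite /barb /=.
have := ler_distD t' t t''; have := ler_distD s' s s''.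
have n1 := ler_normB s s'; have n2 := ler_normB s' s''.
have n3 := lerB_dist s s'; have n4 := lerB_dist s'' s'.
rewrite (distrC s'' s') in n4.
have := normr_ge0 s; have := normr_ge0 s'; have := normr_ge0 s''.
have := ler_normB s s''.
case: (t =P t') => [->|tt']; case: (t' =P t'') => [->|tt'']; rewrite ?eqxx;
  do ?case: eqP => [?|?]; rewrite ?subrr ?normr0; try congruence; lra.
Qed.

End barb.

(** [b n] is the foot and [h n] the height of the [n]-th tooth. *)
Definition comb (R : realType) (b h : nat -> R) : set (R * R) :=
  [set z | 0 <= z.1 <= 2 /\
           (z.2 = 0 \/ exists n, z.1 = b n /\ 0 <= z.2 <= h n)].

(** A name of its own, since the subset type carries the metric of the plane
    and not [barb]. *)
Definition comb_space (R : realType) (b h : nat -> R) : Type :=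
  set_type (comb b h).

Section comb_metric.
Context {R : realType} (b h : nat -> R).
Local Notation X := (comb_space b h).

HB.instance Definition _ := Choice.copy X (set_type (comb b h)).

Definition pos (z : X) : R * R := val z.

Lemma pos_inj : injective pos. Proof. exact: val_inj. Qed.

Lemma posP z : comb b h (pos z). Proof. exact: set_valP. Qed.

Lemma pos1_itv z : 0 <= (pos z).1 <= 2. Proof. by case: (posP z). Qed.

Lemma pos2_ge0 z : 0 <= (pos z).2.
Proof. by have [_ [->//|[n [_ /andP[]]]]] := posP z. Qed.

Definition comb_dist (z w : X) : R := barb (pos z) (pos w).

Let comb_distxx z : comb_dist z z = 0. Proof. exact: barbxx. Qed.

Let comb_dist_pos z w : comb_dist z w = 0 -> z = w.
Proof. by move/barb_positivity/pos_inj. Qed.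

Let comb_dist_sym z w : comb_dist z w = comb_dist w z.
Proof. exact: barb_sym. Qed.

Let comb_dist_triangle y x z : comb_dist x z <= comb_dist x y + comb_dist y z.
Proof. exact: barb_triangle. Qed.

HB.instance Definition _ := @isMetric.Build R X
  comb_dist comb_distxx comb_dist_pos comb_dist_sym comb_dist_triangle.

Lemma mdistE z w : mdist z w = barb (pos z) (pos w). Proof. by []. Qed.

Lemma comb_ballE z r : ball z r = [set w | barb (pos z) (pos w) < r].
Proof. by rewrite ballEmdist. Qed.

End comb_metric.

Lemma expanding_continuous (R : realType) (M N : pseudoMetricType R) (k : R)
    (f : M -> N) : 0 < k ->
  (forall x y e, ball x e y -> ball (f x) (k * e) (f y)) -> continuous f.
Proof.
move=> k0 fk x; apply/cvg_ballP => e e0.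
have : 0 < e / k by rewrite divr_gt0.
move/(nbhsx_ballx x); apply: filterS => y /fk.
by rewrite mulrC divfK // gt_eqF.
Qed.

(** * Connected balls *)

Section comb_topology.
Context {R : realType} (b h : nat -> R).
Local Notation X := (comb_space b h).
Implicit Types z w : X.

Definition comb_pt (p : R * R) (cp : comb b h p) : X := exist _ p (mem_set cp).

(** Clamping makes [base] and [stem] below total and nonexpanding on the real
    line. *)
Definition clamp (u t : R) : R := Num.max 0 (Num.min t u).

Lemma clamp_id (u t : R) : 0 <= t <= u -> clamp u t = t.
Proof. by move=> /andP[t0 tu]; rewrite /clamp (min_idPl tu) (max_idPr t0). Qed.

Lemma clamp_itv (u t : R) : 0 <= u -> 0 <= clamp u t <= u.
Proof.
by move=> u0; rewrite /clamp le_max lexx /= ge_max u0 ge_min lexx orbT.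
Qed.

Lemma clamp_dist (u s t : R) : `|clamp u s - clamp u t| <= `|s - t|.
Proof.
have := ler_norm (s - t); have := ler_norm (t - s); rewrite (distrC t s).
rewrite ler_norml /clamp /Num.max /Num.min.
by repeat case: ifPn; rewrite -?leNgt => *; apply/andP; split; lra.
Qed.

Lemma base_subproof (t : R) : comb b h (clamp 2 t, 0).
Proof. by split; [exact: clamp_itv|left]. Qed.

Definition base (t : R) : X := comb_pt (base_subproof t).

Lemma stem_subproof z (s : R) : comb b h ((pos z).1, clamp (pos z).2 s).
Proof.
split; first exact: pos1_itv.
have /andP[c0 cz] := clamp_itv s (pos2_ge0 z).
have [_ [z0|[n [zn /andP[_ zh]]]]] := posP z.
  by left; apply/le_anti; rewrite /= c0 andbT (le_trans cz) // z0.
by right; exists n; rewrite zn c0 (le_trans cz).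
Qed.

(** The vertical segment under [z]: the comb is closed under lowering a
    point. *)
Definition stem z (s : R) : X := comb_pt (stem_subproof z s).

Lemma base_continuous : continuous base.
Proof.
apply: (@expanding_continuous _ _ _ 1) => // s t e.
rewrite mul1r comb_ballE /= /barb /= subrr normr0 !addr0 if_same addr0.
exact/le_lt_trans/clamp_dist.
Qed.

Lemma stem_continuous z : continuous (stem z).
Proof.
apply: (@expanding_continuous _ _ _ 1) => // s t e.
rewrite mul1r comb_ballE /= /barb /= eqxx subrr normr0 add0r.
exact/le_lt_trans/clamp_dist.
Qed.

Lemma base_posE t : 0 <= t <= 2 -> pos (base t) = (t, 0).
Proof. by move=> t2; rewrite /pos /= clamp_id. Qed.

Lemma stem_posE z s : 0 <= s <= (pos z).2 -> pos (stem z s) = ((pos z).1, s).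
Proof. by move=> sz; rewrite /pos /= clamp_id. Qed.

Lemma pos1_continuous : continuous (fun z => (pos z).1).
Proof.
apply: (@expanding_continuous _ _ _ 1) => // z w e.
rewrite mul1r comb_ballE /= /barb; apply: le_lt_trans.
by rewrite lerDl; case: ifP => _; rewrite ?addr_ge0.
Qed.

Lemma pos2_continuous : continuous (fun z => (pos z).2).
Proof.
apply: (@expanding_continuous _ _ _ 1) => // z w e.
rewrite mul1r comb_ballE /= /barb; apply: le_lt_trans.
case: ifP => _; first by rewrite lerDr.
by rewrite (le_trans (ler_normB _ _)) // lerDr.
Qed.

Lemma stem_segment_connected z (x y : R) : connected (stem z @` `[x, y]).
Proof.
apply: connected_continuous_connected; first exact: segment_connected.
exact/continuous_subspaceT/stem_continuous.
Qed.

Lemma base_segment_connected (x y : R) : connected (base @` `[x, y]).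
Proof.
apply: connected_continuous_connected; first exact: segment_connected.
exact/continuous_subspaceT/base_continuous.
Qed.

Lemma stem_same z w s : (pos z).1 = (pos w).1 -> 0 <= s <= (pos z).2 ->
  s <= (pos w).2 -> stem z s = stem w s.
Proof.
move=> zw /andP[s0 sz] sw.
by apply: pos_inj; rewrite !stem_posE ?s0 ?sz ?sw ?zw.
Qed.

Lemma stem_top z : stem z (pos z).2 = z.
Proof.
by apply: pos_inj; rewrite stem_posE ?pos2_ge0 ?lexx //; case: (pos z).
Qed.

Lemma stem_bot z : stem z 0 = base (pos z).1.
Proof.
by apply: pos_inj; rewrite stem_posE ?pos2_ge0 ?lexx // base_posE // pos1_itv.
Qed.

Lemma barb_stem z w s : 0 <= s <= (pos w).2 -> (pos z).1 = (pos w).1 ->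
  barb (pos z) (pos (stem w s)) = `|(pos z).2 - s|.
Proof. by move=> sw zw; rewrite stem_posE // /barb /= zw eqxx subrr normr0 add0r. Qed.

(** The distance to [z] along the shortest path from [z] to [w] does not
    exceed the distance from [z] to [w].  That path is vertical, or goes down to
    the base, along it, and up again. *)
Lemma ball_link z w r : ball z r w ->
  exists C : set X, [/\ connected C, C z, C w & C `<=` ball z r].
Proof.
rewrite comb_ballE => zwr; rewrite /mkset in zwr.
have [zw|zw] := eqVneq (pos z).1 (pos w).1.
  rewrite /barb zw eqxx subrr normr0 add0r in zwr.
  have [le_zw|/ltW le_wz] := leP (pos z).2 (pos w).2.
    exists (stem w @` `[(pos z).2, (pos w).2]); split.
    - exact: stem_segment_connected.
    - exists (pos z).2; first by rewrite /= in_itv /= lexx le_zw.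
      by rewrite -[RHS]stem_top; apply: stem_same; rewrite ?pos2_ge0.
    - by exists (pos w).2; [rewrite /= in_itv /= lexx le_zw|exact: stem_top].
    - move=> _ [s s_in <-].
      have /andP[zs sw] : (pos z).2 <= s <= (pos w).2 := s_in.
      rewrite /mkset barb_stem ?sw ?(le_trans (pos2_ge0 z)) //.
      apply: le_lt_trans zwr; rewrite ler0_norm ?subr_le0 //.
      by rewrite ler0_norm ?subr_le0 // lerN2 lerB.
  exists (stem z @` `[(pos w).2, (pos z).2]); split.
  - exact: stem_segment_connected.
  - by exists (pos z).2; [rewrite /= in_itv /= lexx le_wz|exact: stem_top].
  - exists (pos w).2; first by rewrite /= in_itv /= lexx le_wz.
    by rewrite -[RHS]stem_top; apply: stem_same; rewrite ?pos2_ge0.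
  - move=> _ [s s_in <-].
    have /andP[ws sz] : (pos w).2 <= s <= (pos z).2 := s_in.
    rewrite /mkset barb_stem ?sz ?(le_trans (pos2_ge0 w)) //.
    apply: le_lt_trans zwr; rewrite ger0_norm ?subr_ge0 //.
    by rewrite ger0_norm ?subr_ge0 // lerB.
rewrite /barb (negbTE zw) !(@ger0_norm _ (pos _).2) ?pos2_ge0 // in zwr.
set p := Num.min (pos z).1 (pos w).1; set q := Num.max (pos z).1 (pos w).1.
have z12 := pos1_itv z; have w12 := pos1_itv w.
have pz : p <= (pos z).1 <= q by rewrite /p /q ge_min le_max lexx.
have pw : p <= (pos w).1 <= q by rewrite /p /q ge_min le_max lexx !orbT.
have z2 := pos2_ge0 z; have w2 := pos2_ge0 w.
exists (stem z @` `[0, (pos z).2] `|` base @` `[p, q] `|`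
        stem w @` `[0, (pos w).2]); split.
- apply: connectedU; last exact: stem_segment_connected.
    exists (base (pos w).1); split.
      by right; exists (pos w).1.
    by exists 0; [rewrite /= in_itv /= lexx w2|exact: stem_bot].
  apply: connectedU; first last.
  + exact: base_segment_connected.
  + exact: stem_segment_connected.
  exists (base (pos z).1); split; last by exists (pos z).1.
  by exists 0; [rewrite /= in_itv /= lexx z2|exact: stem_bot].
- left; left; exists (pos z).2; last exact: stem_top.
  by rewrite /= in_itv /= lexx z2.
- right; exists (pos w).2; last exact: stem_top.
  by rewrite /= in_itv /= lexx w2.
- have n0 := normr_ge0 ((pos z).1 - (pos w).1).
  move=> _ [[[s s_in <-]|[s s_in <-]]|[s s_in <-]].
  + have /andP[s0 s1] : 0 <= s <= (pos z).2 := s_in.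
    rewrite /mkset barb_stem ?s0 //.
    by rewrite ger0_norm ?subr_ge0 //; lra.
  + have /andP[s0 s1] : p <= s <= q := s_in.
    have s2 : 0 <= s <= 2.
      rewrite (le_trans _ s0) ?(le_trans s1) //.
        by rewrite /q ge_max; move: z12 w12 => /andP[_ ->] /andP[_ ->].
      by rewrite /p le_min; move: z12 w12 => /andP[-> _] /andP[-> _].
    rewrite /mkset base_posE // /barb /= normr0 subr0 addr0 if_same.
    rewrite (ger0_norm z2).
    suff : `|(pos z).1 - s| <= `|(pos z).1 - (pos w).1| by lra.
    move: s0 s1; rewrite /p /q.
    have [le_zw|/ltW le_wz] := leP (pos z).1 (pos w).1 => s0 s1.
      by rewrite ler0_norm ?subr_le0 // ler0_norm ?subr_le0 //; lra.
    by rewrite ger0_norm ?subr_ge0 // ger0_norm ?subr_ge0 //; lra.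
  + have /andP[s0 s1] : 0 <= s <= (pos w).2 := s_in.
    rewrite /mkset stem_posE ?s0 // /barb /= (negbTE zw).
    by rewrite (ger0_norm z2) (ger0_norm s0); lra.
Qed.

Lemma comb_ball_connected z r : 0 < r -> connected (ball z r).
Proof.
move=> r0; have zz : ball z r z by exact: ballxx.
suff -> : ball z r = connected_component (ball z r) z.
  exact: component_connected.
apply/seteqP; split; last exact: connected_component_sub.
by move=> w /ball_link[C [cC Cz Cw Cr]]; exists C.
Qed.

Lemma comb_locally_connected : locally_connected X.
Proof.
move=> z U /nbhs_ballP[r /= r0 zrU]; exists (ball z r); split => //.
- rewrite openE => w zrw; apply/nbhs_ballP; exists (r - mdist z w) => /=.
    by rewrite subr_gt0; move: zrw; rewrite ballEmdist.
  rewrite !ballEmdist => v /= wv.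
  by rewrite (le_lt_trans (metric_triangle _ w _)) //; lra.
- exact: comb_ball_connected.
- exact: ballxx.
Qed.
End comb_topology.

(** * The comb is a dendrite *)

Section comb_dendrite.
Context {R : realType} (b h : nat -> R).
Local Notation X := (comb_space b h).
Implicit Types z w : X.

Lemma ultra_limit (F : set_system X) (g : X -> R) (x y : R) :
    UltraFilter F -> (forall z, x <= g z <= y) ->
  exists2 t, x <= t <= y & forall e, 0 < e -> F [set z | `|t - g z| < e].
Proof.
move=> FU gxy.
have [|t [txy tF]] := @segment_compact R x y (g @ F) _.
  by apply: (@filterS _ F _ setT) filterT => z _; exact: gxy.
exists t => [|e e0]; first by move: txy; rewrite /= in_itv.
have [//|Fn] := in_ultra_setVsetC [set z | `|t - g z| < e] FU.
have [||v [/= + tv]] := tF (~` ball t e) (ball t e).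
- exact: Fn.
- exact: nbhsx_ballx.
- by [].
Qed.

Lemma ultra_finite_union (T : Type) (F : set_system T) (A : nat -> set T) N :
  UltraFilter F -> F [set z | exists2 n, (n < N)%N & A n z] ->
  exists n, F (A n).
Proof.
move=> FU; elim: N => [|N IHN] FN.
  by have [z [n]] := filter_ex FN.
have [FA|FnA] := in_ultra_setVsetC (A N) FU; first by exists N.
apply: IHN; apply: (filterS _ (filterI FN FnA)) => z [[n nN Az] nAz].
exists n => //; rewrite ltn_neqAle -ltnS nN andbT.
by apply/eqP => nN'; apply: nAz; rewrite -nN'.
Qed.

Hypothesis hM : forall n, h n <= h 0.
Hypothesis h_small : forall e, 0 < e -> exists N, forall n, (N <= n)%N -> h n < e.

Lemma comb_pos2_le z : (pos z).2 <= Num.max 0 (h 0).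
Proof.
rewrite le_max; have [_ [->|[n [_ /andP[_ zh]]]]] := posP z; first by rewrite lexx.
by rewrite (le_trans zh (hM n)) orbT.
Qed.

(** The coordinates converge along an ultrafilter.  If the limit height is 0,
    then so does the point, towards the base.  Otherwise the filter lives on the
    finitely many teeth that are high enough, hence on one of them. *)
Lemma comb_compact : compact [set: X].
Proof.
rewrite compact_ultra => F FU _.
have [t t2 tF] := ultra_limit FU (@pos1_itv R b h).
have [|s s2 sF] := @ultra_limit F (fun z => (pos z).2) 0 (Num.max 0 (h 0)) FU.
  by move=> z; rewrite pos2_ge0 comb_pos2_le.
have /andP[s0 _] := s2.
suff [p pF] : exists p : X, forall e, 0 < e -> F (ball p e).
  exists p; split=> // A /nbhs_ballP[e e0 eA]; exact: (filterS eA (pF _ e0)).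
move: s0; rewrite le_eqVlt => /orP[/eqP s0|s0].
  exists (base b h t) => e e0; rewrite comb_ballE.
  have e2 : 0 < e / 2 by rewrite divr_gt0.
  apply: (filterS _ (filterI (tF _ e2) (sF _ e2))) => z /= [tz].
  rewrite -s0 sub0r normrN => sz; rewrite base_posE // /barb /=.
  rewrite normr0 sub0r normrN add0r if_same; lra.
have [N hN] : exists N, forall n, (N <= n)%N -> h n < s / 2.
  by apply: h_small; rewrite divr_gt0.
pose A n := [set z : X | (pos z).1 = b n /\ (pos z).2 <= h n].
have [n Fn] : exists n, F (A n).
  apply: (@ultra_finite_union _ F A N FU).
  have /sF Fs : 0 < s / 2 by rewrite divr_gt0.
  apply: (filterS _ Fs) => z /= sz.
  have sz' := ler_norm (s - (pos z).2).
  have [_ [z0|[n [zn /andP[_ zh]]]]] := posP z; first by rewrite z0 in sz sz'; lra.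
  exists n => //; rewrite ltnNge; apply/negP => /hN; lra.
have tb : t = b n.
  apply/eqP; rewrite -subr_eq0 -normr_eq0; apply/negPn/negP => tn.
  have /tF Ft : 0 < `|t - b n| by rewrite lt_neqAle eq_sym tn normr_ge0.
  have [z /= [tz [zb _]]] := filter_ex (filterI Ft Fn).
  by move: tz; rewrite zb ltxx.
have sh : s <= h n.
  rewrite leNgt; apply/negP => hs.
  have /sF Fs : 0 < s - h n by rewrite subr_gt0.
  have [z /= [+ [_ zh]]] := filter_ex (filterI Fs Fn).
  by have := ler_norm (s - (pos z).2); lra.
have cp : comb b h (b n, s).
  by split; [rewrite -tb|right; exists n; rewrite /= (ltW s0) sh].
exists (comb_pt cp) => e /sF Fs; rewrite comb_ballE.
apply: (filterS _ (filterI Fs Fn)) => z /= [sz [zb _]].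
by rewrite /barb zb /= eqxx subrr normr0 add0r.
Qed.

Lemma comb_mdist_le z w : mdist z w <= 2 + 2 * Num.max 0 (h 0).
Proof.
rewrite mdistE /barb.
have /andP[z0 z2] := pos1_itv z; have /andP[w0 w2] := pos1_itv w.
have sz := pos2_ge0 z; have sw := pos2_ge0 w.
have hz := comb_pos2_le z; have hw := comb_pos2_le w.
have n1 : `|(pos z).1 - (pos w).1| <= 2 by rewrite ler_norml; apply/andP; split; lra.
have n2 := ler_normB (pos z).2 (pos w).2.
have e1 := ger0_norm sz; have e2 := ger0_norm sw.
by case: ifP => _; lra.
Qed.

Lemma comb_connected : connected [set: X].
Proof.
pose z0 := base b h 0.
have -> : [set: X] = ball z0 (3 + 2 * Num.max 0 (h 0)).
  apply/esym/seteqP; split=> // z _; rewrite ballEmdist /mkset.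
  by rewrite (le_lt_trans (comb_mdist_le _ _)) // ltrD2r ltr_nat.
apply: comb_ball_connected; rewrite ltr_wpDr // mulr_ge0 // le_max lexx //.
Qed.

(** On an embedded circle the first coordinate is constant, since otherwise it
    would take twice some value [v] off the feet, above which there is only the
    point [(v, 0)].  Then the second coordinate is injective, and cannot take an
    intermediate value twice. *)
Lemma comb_no_circle : ~ exists A : set X, homeomorphic A (circle R).
Proof.
move=> [A [g [k [gk kg _ kc]]]].
pose psi := fun q : circle R => pos (val (k q)).
have psi_inj q q' : psi q = psi q' -> q = q'.
  by move=> /pos_inj /val_inj e; rewrite -[q]kg e kg.
have vc : continuous (fun q => val (k q)).
  move=> q; apply: (@continuous_comp _ _ _ k val); first exact: kc.
  exact: initial_continuous.
have c1 : continuous (fun q => (psi q).1).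
  move=> q.
  apply: (@continuous_comp _ _ _ _ (fun z : X => (pos z).1) q (vc q)).
  exact: pos1_continuous.
have c2 : continuous (fun q => (psi q).2).
  move=> q.
  apply: (@continuous_comp _ _ _ _ (fun z : X => (pos z).2) q (vc q)).
  exact: pos2_continuous.
have cb : countable (range b).
  exact: sub_countable (card_image_le _ _) (countableP _).
have step p q : (psi p).1 < (psi q).1 -> False.
  move=> pq; have [v pvq nv] := uncountable_gap cb pq.
  have [c [d [cd cv dv]]] := circle_level_two c1 pvq.
  have off z : (pos z).1 = v -> pos z = (v, 0).
    have [_] := posP z; case: (pos z) => [x y] /= + xv.
    by case=> [->|[n [xn _]]]; [rewrite xv|case: nv; exists n; rewrite -?xn].
  by apply: cd; apply: psi_inj; rewrite /psi (off _ cv) (off _ dv).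
have same p q : (psi p).1 = (psi q).1.
  by have [/step|/step|] := ltgtP (psi p).1 (psi q).1.
have step2 p q : (psi p).2 < (psi q).2 -> False.
  move=> pq; have mid : (psi p).2 < ((psi p).2 + (psi q).2) / 2 < (psi q).2.
    by rewrite !midf_lt.
  have [c [d [cd cv dv]]] := circle_level_two c2 mid.
  apply: cd; apply: psi_inj; move: (same c d) cv dv.
  by case: (psi c) => [x y]; case: (psi d) => [x' y'] /= -> -> ->.
have [p [q pq]] := @circle_two_points R; apply: pq; apply: psi_inj.
have := same p q; have := step2 p q; have := step2 q p.
case: (psi p) => [x y]; case: (psi q) => [x' y'] /= l1 l2 ->; congr pair.
by have [/l2|/l1|] := ltgtP y y'.
Qed.

Lemma comb_dendrite : dendrite X.
Proof.
split; [exact: comb_compact|exact: comb_connected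
  |exact: comb_locally_connected|exact: comb_no_circle].
Qed.

Lemma comb_diam : 2 <= diam X.
Proof.
apply: ub_le_sup.
  exists (2 + 2 * Num.max 0 (h 0)) => _ [p _ <-]; exact: comb_mdist_le.
exists (base b h 0, base b h 2) => //=.
rewrite mdistE !base_posE ?lexx ?ler0n // /barb /=.
by rewrite sub0r subrr normrN normr0 addr0 if_same addr0 ger0_norm.
Qed.

End comb_dendrite.

(** * The map that shifts the teeth *)

Section shift.
Context {R : realType} (b h : nat -> R).
Local Notation X := (comb_space b h).
Implicit Types z w : X.

Hypothesis b_itv : forall n, 0 <= b n <= 2.
Hypothesis b_inj : injective b.
Hypothesis h_gt0 : forall n, 0 < h n.
Hypothesis h_noninc : forall n, h n.+1 <= h n.
Hypothesis b_slow : forall n, `|b n.+1 - b n| <= h n.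

Lemma tooth_subproof n (s : R) : comb b h (b n, clamp (h n) s).
Proof.
split; first exact: b_itv.
by right; exists n; split=> //; apply: clamp_itv; exact: ltW.
Qed.

Definition tooth n (s : R) : X := comb_pt (tooth_subproof n s).

Lemma tooth_posE n s : 0 <= s <= h n -> pos (tooth n s) = (b n, s).
Proof. by move=> sh; rewrite /pos /= clamp_id. Qed.

Lemma pos2_tooth z n : (pos z).1 = b n -> (pos z).2 <= h n.
Proof.
have [_ [->|[m [-> /andP[_ +]]]]] := posP z; first by rewrite ltW.
by move=> + /b_inj <-.
Qed.

(** The image of the point at height [s] on the [n]-th tooth. *)
Definition slide n (s : R) : X :=
  if 2 * s <= h n then base b h (b n + 2 * s / h n * (b n.+1 - b n))
  else tooth n.+1 ((2 * s / h n - 1) * h n.+1).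

Lemma slide_lower n s : 0 <= s -> 2 * s <= h n ->
  pos (slide n s) = (b n + 2 * s / h n * (b n.+1 - b n), 0).
Proof.
move=> s0 sh; rewrite /slide sh base_posE //.
have /andP[b0 b2] := b_itv n; have /andP[c0 c2] := b_itv n.+1.
have : 0 <= 2 * s / h n <= 1.
  rewrite ler_pdivrMr ?mul1r // sh andbT.
  by rewrite divr_ge0 ?mulr_ge0 // ltW.
move: (2 * s / h n) => u /andP[u0 u1].
by apply/andP; split; nra.
Qed.

Lemma slide_upper n s : h n < 2 * s -> s <= h n ->
  pos (slide n s) = (b n.+1, (2 * s / h n - 1) * h n.+1).
Proof.
move=> hs sh; rewrite /slide leNgt hs /= tooth_posE //.
have : 1 <= 2 * s / h n <= 2.
  by rewrite ler_pdivlMr // mul1r ler_pdivrMr // (ltW hs) /=; lra.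
move: (2 * s / h n) => u /andP[u0 u1]; have := h_gt0 n.+1 => h0.
by apply/andP; split; nra.
Qed.

Lemma slide0 n : slide n 0 = base b h (b n).
Proof. by rewrite /slide mulr0 ltW // mul0r mul0r addr0. Qed.

(** On the lower half the speed is [2 * |b (n+1) - b n| / h n], on the upper
    half [2 * h (n+1) / h n]: both are at most 2. *)
Lemma slide_dist n s t : 0 <= s <= h n -> 0 <= t <= h n ->
  mdist (slide n s) (slide n t) <= 2 * `|s - t|.
Proof.
wlog st : s t / s <= t => [hw|].
  by have [/hw//|/ltW/hw + *] := leP s t; rewrite metric_sym distrC; exact.
move=> /andP[s0 sh] /andP[t0 th].
rewrite (@ler0_norm _ (s - t)) ?subr_le0 // opprB mdistE.
have hn := h_gt0 n; have hn1 := h_gt0 n.+1; have hh := h_noninc n.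
have dh := b_slow n; have d0 := normr_ge0 (b n.+1 - b n).
have es : 2 * s = (2 * s / h n) * h n by rewrite divfK ?gt_eqF.
have et : 2 * t = (2 * t / h n) * h n by rewrite divfK ?gt_eqF.
have [th2|th2] := leP (2 * t) (h n); have [sh2|sh2] := leP (2 * s) (h n).
- rewrite !slide_lower // /barb /= subrr normr0 addr0 if_same addr0.
  move: es et; move: (2 * s / h n) (2 * t / h n) => u v es et.
  have uv : u <= v by rewrite -(ler_pM2r hn) -es -et ler_pM2l.
  have -> : b n + u * (b n.+1 - b n) - (b n + v * (b n.+1 - b n)) =
    (u - v) * (b n.+1 - b n) by ring.
  rewrite normrM (@ler0_norm _ (u - v)) ?subr_le0 // opprB.
  have vu : 0 <= v - u by rewrite subr_ge0.
  by have := ler_wpM2l vu dh; lra.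
- by exfalso; lra.
- rewrite slide_lower // slide_upper // /barb /= sub0r normrN normr0 add0r if_same.
  have u1 : 2 * s / h n <= 1 by rewrite ler_pdivrMr ?mul1r.
  have v1 : 1 <= 2 * t / h n by rewrite ler_pdivlMr ?mul1r ?ltW.
  move: es et u1 v1; move: (2 * s / h n) (2 * t / h n) => u v es et u1 v1.
  have -> : b n + u * (b n.+1 - b n) - b n.+1 = (u - 1) * (b n.+1 - b n) by ring.
  rewrite !normrM (ger0_norm (ltW hn1)) (@ler0_norm _ (u - 1)) ?subr_le0 //.
  rewrite opprB (@ger0_norm _ (v - 1)) ?subr_ge0 //.
  have u10 : 0 <= 1 - u by rewrite subr_ge0.
  have v10 : 0 <= v - 1 by rewrite subr_ge0.
  by have := ler_wpM2l u10 dh; have := ler_wpM2l v10 hh; lra.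
- rewrite !slide_upper // /barb /= eqxx subrr normr0 add0r.
  move: es et; move: (2 * s / h n) (2 * t / h n) => u v es et.
  have uv : u <= v by rewrite -(ler_pM2r hn) -es -et ler_pM2l.
  have -> : (u - 1) * h n.+1 - (v - 1) * h n.+1 = (u - v) * h n.+1 by ring.
  rewrite normrM (@ler0_norm _ (u - v)) ?subr_le0 // (ger0_norm (ltW hn1)) opprB.
  have vu : 0 <= v - u by rewrite subr_ge0.
  by have := ler_wpM2l vu hh; lra.
Qed.

Definition comb_shift z : X :=
  if pselect (exists n, (pos z).1 = b n) is left e
  then slide (sval (cid e)) (pos z).2 else z.

Lemma shift_tooth z n : (pos z).1 = b n -> comb_shift z = slide n (pos z).2.
Proof.
move=> zn; rewrite /comb_shift; case: pselect => [e|[]]; last by exists n.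
by case: (cid e) => m /= zm; congr slide; apply: b_inj; rewrite -zm.
Qed.

Lemma shift_off z : ~ (exists n, (pos z).1 = b n) -> comb_shift z = z.
Proof. by move=> nz; rewrite /comb_shift; case: pselect. Qed.

Lemma shift_base z : (pos z).2 = 0 -> comb_shift z = z.
Proof.
move=> z0; have [[n zn]|/shift_off//] := pselect (exists n, (pos z).1 = b n).
rewrite (shift_tooth zn) z0 slide0 -zn; apply: pos_inj.
by rewrite base_posE ?pos1_itv // -z0; case: (pos z).
Qed.

Lemma shift_foot z : mdist (comb_shift z) (base b h (pos z).1) <= 2 * (pos z).2.
Proof.
have z0 := pos2_ge0 z.
have [[n zn]|nz] := pselect (exists n, (pos z).1 = b n).
  rewrite (shift_tooth zn) zn -slide0 (le_trans (slide_dist _ _)) //.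
  - by rewrite z0 pos2_tooth.
  - by rewrite lexx ltW.
  - by rewrite subr0 ger0_norm.
rewrite shift_off // mdistE base_posE ?pos1_itv // /barb /= eqxx.
by rewrite subrr normr0 subr0 ger0_norm //; lra.
Qed.

(** Points on distinct teeth are compared through their feet, which are
    fixed. *)
Lemma shift_dist z w : mdist (comb_shift z) (comb_shift w) <= 2 * mdist z w.
Proof.
have [zw|zw] := eqVneq (pos z).1 (pos w).1; last first.
  rewrite (le_trans (metric_triangle _ (base b h (pos z).1) _)) //.
  have := shift_foot z; have := shift_foot w; rewrite (metric_sym (comb_shift w)).
  have := metric_triangle (base b h (pos z).1) (base b h (pos w).1) (comb_shift w).
  rewrite [mdist z w]mdistE.
  rewrite [mdist (base b h (pos z).1) (base b h (pos w).1)]mdistE.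
  rewrite !base_posE ?pos1_itv // /barb /= subrr normr0 addr0 if_same addr0.
  rewrite (negbTE zw) !(@ger0_norm _ (pos _).2) ?pos2_ge0 //.
  by have := normr_ge0 ((pos z).1 - (pos w).1); lra.
have [[n zn]|nz] := pselect (exists n, (pos z).1 = b n); last first.
  have nw : ~ exists n, (pos w).1 = b n by rewrite -zw.
  by rewrite !shift_off // ler_peMl ?mdist_ge0 // ler1n.
have wn : (pos w).1 = b n by rewrite -zw.
rewrite (shift_tooth zn) (shift_tooth wn).
rewrite (le_trans (slide_dist _ _)) ?pos2_ge0 ?pos2_tooth //.
by rewrite mdistE /barb zw eqxx subrr normr0 add0r.
Qed.

Lemma shift_continuous : continuous comb_shift.
Proof.
apply: (@expanding_continuous _ _ _ 2) => // z w e.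
rewrite !ballEmdist /mkset => zw; rewrite (le_lt_trans (shift_dist _ _)) //.
by rewrite ltr_pM2l.
Qed.

(** * The two possible fates of a point *)

Definition tip n : X := tooth n (h n).

Lemma tip_posE n : pos (tip n) = (b n, h n).
Proof. by rewrite tooth_posE // lexx ltW. Qed.

Lemma shift_tip n : comb_shift (tip n) = tip n.+1.
Proof.
have hn := h_gt0 n; rewrite (@shift_tooth _ n) ?tip_posE //=.
apply: pos_inj; rewrite tip_posE slide_upper //; last by lra.
by rewrite mulfK ?gt_eqF // -[X in _ - X]/(1%:R) -natrB // mul1r.
Qed.

Lemma iter_shift_tip n k : iter k comb_shift (tip n) = tip (n + k).
Proof. by elim: k => [|k IHk]; rewrite ?addn0 // iterS IHk shift_tip addnS. Qed.

Definition settled z := exists K, (pos (iter K comb_shift z)).2 = 0.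

Lemma settled_shift z : settled (comb_shift z) -> settled z.
Proof. by move=> [K zK]; exists K.+1; rewrite iterSr. Qed.

Lemma settled_stays z : settled z ->
  exists K p, forall k, (K <= k)%N -> iter k comb_shift z = p.
Proof.
move=> [K zK]; exists K, (iter K comb_shift z) => k /subnK <-.
by elim: (k - K)%N => // j IHj; rewrite addSn iterS IHj shift_base.
Qed.

(** The relative distance [(h n - s) / h n] to the tip doubles at each step as
    long as the point stays in the upper half of its tooth. *)
Lemma settled_tooth k n s : 0 <= s <= h n -> h n <= 2 ^+ k * (h n - s) ->
  settled (tooth n s).
Proof.
elim: k n s => [|k IHk] n s /[dup] shn /andP[s0 sh] hk.
  exists 0%N; rewrite [iter _ _ _]/= tooth_posE //; move: hk; rewrite expr0 /=; lra.
apply: settled_shift; rewrite (@shift_tooth _ n) tooth_posE //=.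
have [sh2|sh2] := leP (2 * s) (h n).
  by exists 0%N; rewrite [iter _ _ _]/= slide_lower.
rewrite /slide leNgt sh2 /=; apply: IHk.
  have : 1 <= 2 * s / h n <= 2.
    by rewrite ler_pdivlMr // mul1r ler_pdivrMr // (ltW sh2) /=; lra.
  move: (2 * s / h n) => u /andP[u0 u1]; have := h_gt0 n.+1 => h0.
  by apply/andP; split; nra.
have -> : h n.+1 - (2 * s / h n - 1) * h n.+1 = h n.+1 * (2 * (h n - s) / h n).
  by field; rewrite gt_eqF.
rewrite mulrCA -[leLHS]mulr1 ler_pM2l // !mulrA ler_pdivlMr // mul1r.
by rewrite -exprSr.
Qed.

Lemma fate z : settled z \/ exists n, z = tip n.
Proof.
have [_ [z0|[n [zn /andP[z0 zh]]]]] := posP z; first by left; exists 0.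
have ez : z = tooth n (pos z).2.
  by apply: pos_inj; rewrite tooth_posE ?z0 //= -zn; case: (pos z).
move: zh; rewrite le_eqVlt => /orP[/eqP zh|zh].
  by right; exists n; rewrite ez zh.
left; rewrite ez.
pose x := h n / (h n - (pos z).2).
have d0 : 0 < h n - (pos z).2 by rewrite subr_gt0.
apply: (@settled_tooth (Num.truncn x).+1); first by rewrite z0 ltW.
rewrite -ler_pdivrMr // -/x.
rewrite (le_trans (ltW (truncnS_gt x))) // -natrX ler_nat.
exact/ltnW/ltn_expl.
Qed.

End shift.

(** * Frequencies of long runs *)

Section frequency.
Context {R : realType}.
Implicit Types P : pred nat.

(** The quantity whose lower and upper limits define the distribution
    functions, for an arbitrary set [P] of times. *)
Definition freq P (n : nat) : R := n%:R^-1 * #|[pred k : 'I_n.+1 | P k]|%:R.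

Lemma card_pred_iota P n : #|[pred k : 'I_n.+1 | P k]| = count P (iota 0 n.+1).
Proof. by rewrite -val_enum_ord count_map -size_filter cardE /enum_mem filter_predT. Qed.

Lemma card_run_false P m n : (forall k, (m <= k <= n)%N -> ~~ P k) ->
  (#|[pred k : 'I_n.+1 | P k]| <= m)%N.
Proof.
move=> Pmn; rewrite card_pred_iota; have [mn|nm] := leqP m n.+1; last first.
  by rewrite (leq_trans (count_size _ _)) // size_iota ltnW.
rewrite -[n.+1](subnKC mn) iotaD count_cat.
rewrite [X in (_ + X)%N](_ : _ = 0%N) ?addn0.
  by rewrite (leq_trans (count_size _ _)) // size_iota.
apply/eqP; rewrite eqn0Ngt -has_count; apply/hasPn => k.
by rewrite mem_iota add0n subnKC // ltnS; exact: Pmn.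
Qed.

Lemma card_run_true P m n : (forall k, (m <= k <= n)%N -> P k) ->
  (n.+1 <= #|[pred k : 'I_n.+1 | P k]| + m)%N.
Proof.
move=> Pmn; rewrite -[X in (X <= _)%N](size_iota 0) -(count_predC P) card_pred_iota.
rewrite leq_add2l -(@card_pred_iota (predC P)); apply: card_run_false => k /Pmn Pk.
by rewrite /= Pk.
Qed.

Lemma freq_ge0 P n : 0 <= freq P n.
Proof. by rewrite mulr_ge0 ?invr_ge0. Qed.

Lemma freq_le P n : freq P n <= 1 + n%:R^-1.
Proof.
have [->|n0] := posnP n; first by rewrite /freq invr0 mul0r addr0.
rewrite /freq ler_pdivrMl ?ltr0n // mulrDr mulr1 mulfV ?pnatr_eq0 -?lt0n //.
by rewrite natr1 ler_nat (leq_trans (max_card _)) // card_ord.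
Qed.

Lemma freq_bounded P : bounded_fun (freq P : R^o^nat).
Proof.
exists 2; split=> // x x2 n _; rewrite /= ger0_norm ?freq_ge0 //.
apply: le_trans (ltW x2); apply: le_trans (freq_le P n) _.
rewrite -[leRHS]/(1 + 1) lerD2l; have [->|n0] := posnP n; first by rewrite invr0.
by rewrite invf_le1 ?ltr0n // ler1n.
Qed.

(** [P] holds on windows [[m, n]] with [n / m] as large as desired. *)
Definition long_runs P := forall N, exists m n : nat,
  [/\ (0 < m)%N, (N * m <= n)%N & forall k, (m <= k <= n)%N -> P k].

Lemma freq_run_true P m n : (0 < n)%N -> (forall k, (m <= k <= n)%N -> P k) ->
  1 - m%:R / n%:R <= freq P n.
Proof.
move=> n0 Pmn; rewrite /freq [leRHS]mulrC ler_pdivlMr ?ltr0n //.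
rewrite mulrBl mul1r divfK ?pnatr_eq0 -?lt0n // lerBlDr -natrD ler_nat.
exact: ltnW (card_run_true Pmn).
Qed.

Lemma freq_run_false P m n : (0 < n)%N ->
  (forall k, (m <= k <= n)%N -> ~~ P k) -> freq P n <= m%:R / n%:R.
Proof.
move=> n0 Pmn; rewrite /freq [leLHS]mulrC ler_pM2r ?invr_gt0 ?ltr0n // ler_nat.
exact: card_run_false.
Qed.

Lemma exists_inv_lt (e : R) : 0 < e -> exists2 N, (0 < N)%N & N%:R^-1 < e.
Proof.
move=> e0; exists (Num.truncn e^-1).+1 => //.
by rewrite invf_plt ?posrE ?ltr0n // truncnS_gt.
Qed.

Lemma run_ratio N m n : (0 < N)%N -> (0 < m)%N -> (N * m <= n)%N ->
  m%:R / n%:R <= N%:R^-1 :> R.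
Proof.
move=> N0 m0 Nmn; have n0 : (0 < n)%N by rewrite (leq_trans _ Nmn) // muln_gt0 N0.
by rewrite ler_pdivrMr ?ltr0n // ler_pdivlMl ?ltr0n // -natrM ler_nat.
Qed.

(** The times before [m] have a negligible frequency among those up to [n]. *)
Lemma limn_sup_freq P : long_runs P -> limn_sup (freq P) = 1.
Proof.
move=> runs; have bP := freq_bounded P; rewrite limn_supE //.
have bS := has_ubound_sdrop (bounded_fun_has_ubound bP).
apply/eqP; rewrite eq_le; apply/andP; split; apply/ler_addgt0Pr => e e0.
  have [N N0 Ne] := exists_inv_lt e0.
  apply: (@le_trans _ _ (sups (freq P) N)).
    apply: ge_inf; [exact: bounded_fun_has_lbound_sups|by exists N].
  apply: ge_sup; first by exists (freq P N); exists N => /=.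
  move=> _ [n /= Nn <-]; apply: le_trans (freq_le P n) _.
  rewrite lerD2l; apply: le_trans (ltW Ne).
  by rewrite lef_pV2 ?posrE ?ltr0n ?ler_nat // (leq_trans N0).
rewrite -lerBlDr; apply: lb_le_inf; first by exists (sups (freq P) 0); exists 0%N.
move=> _ [M _ <-]; have [N N0 Ne] := exists_inv_lt e0.
have [m [n [m0 mn Pmn]]] := runs (maxn N M).
have Nmn : (N * m <= n)%N by rewrite (leq_trans _ mn) // leq_mul2r leq_maxl orbT.
have Mn : (M <= n)%N.
  by rewrite (leq_trans _ mn) // (leq_trans (leq_maxr N M)) // leq_pmulr.
have n0 : (0 < n)%N by rewrite (leq_trans _ Nmn) // muln_gt0 N0.
apply: (@le_trans _ _ (freq P n)); last first.
  by apply: ub_le_sup; [exact: bS|exists n].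
apply: le_trans (freq_run_true n0 Pmn); rewrite lerB //.
exact: le_trans (run_ratio N0 m0 Nmn) (ltW Ne).
Qed.

Lemma limn_inf_freq P : long_runs (predC P) -> limn_inf (freq P) = 0.
Proof.
move=> runs; have bP := freq_bounded P; rewrite limn_infE //.
have bI := has_lbound_sdrop (bounded_fun_has_lbound bP).
apply/eqP; rewrite eq_le; apply/andP; split; last first.
  apply: (@le_trans _ _ (infs (freq P) 0)).
    apply: lb_le_inf; first by exists (freq P 0); exists 0%N.
    by move=> _ [n _ <-]; exact: freq_ge0.
  by apply: ub_le_sup; [exact: bounded_fun_has_ubound_infs|exists 0%N].
apply/ler_addgt0Pr => e e0; rewrite add0r.
apply: ge_sup; first by exists (infs (freq P) 0); exists 0%N.
move=> _ [M _ <-]; have [N N0 Ne] := exists_inv_lt e0.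
have [m [n [m0 mn Pmn]]] := runs (maxn N M).
have Nmn : (N * m <= n)%N by rewrite (leq_trans _ mn) // leq_mul2r leq_maxl orbT.
have Mn : (M <= n)%N.
  by rewrite (leq_trans _ mn) // (leq_trans (leq_maxr N M)) // leq_pmulr.
have n0 : (0 < n)%N by rewrite (leq_trans _ Nmn) // muln_gt0 N0.
apply: (@le_trans _ _ (freq P n)); first by apply: ge_inf; [exact: bI|exists n].
apply: le_trans (freq_run_false n0 Pmn) _.
exact: le_trans (run_ratio N0 m0 Nmn) (ltW Ne).
Qed.

Lemma cvg_freq P (v : bool) K : (forall k, (K <= k)%N -> P k = v) ->
  freq P @ \oo --> (v%:R : R^o).
Proof.
move=> Pv; apply/cvgrPdist_le => e e0; have [N N0 Ne] := exists_inv_lt e0.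
exists (N * K.+1)%N => // n /= Nn.
have n0 : (0 < n)%N by rewrite (leq_trans _ Nn) // muln_gt0 N0.
have Kn : K.+1%:R / n%:R <= e :> R.
  by apply: le_trans (ltW Ne); exact: run_ratio.
have n1 : n%:R^-1 <= K.+1%:R / n%:R :> R.
  by rewrite ler_peMl ?invr_ge0 // ler1n.
have nK : K%:R / n%:R <= K.+1%:R / n%:R :> R.
  by rewrite ler_pM2r ?invr_gt0 ?ltr0n // ler_nat.
have f0 := freq_ge0 P n; have f1 := freq_le P n.
case: v Pv => Pv.
  have := @freq_run_true P K n n0 (fun k Kk => Pv _ (andP Kk).1).
  by rewrite /= ler_distlC; lra.
have f2 := @freq_run_false P K n n0 _.
rewrite sub0r normrN ger0_norm // (le_trans (f2 _)) ?(le_trans nK) //.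
by move=> k /andP[/Pv ->].
Qed.

End frequency.

(** * Criteria for being a DC pair or not *)

Section DC_criteria.
Context {R : realType} {X : metricType R}.
Variables (f : X -> X) (x y : X).

Definition close_at (delta : R) : pred nat :=
  fun k => mdist (iter k f x) (iter k f y) < delta.

Lemma close_freqE delta : close_freq f x y delta = freq (close_at delta).
Proof. by []. Qed.

(** These hypotheses give the strongest values: the upper distribution function
    is 1 at every positive distance and the lower one is 0 up to [eps]. *)
Lemma DC_pair_of_runs (i : dc_index) (eps : R) : 0 < eps <= diam X ->
    (forall delta, 0 < delta -> long_runs (close_at delta)) ->
    long_runs (predC (close_at eps)) ->
  DC_pair i f x y.
Proof.
move=> /andP[e0 eX] runs far.
have S1 delta : 0 < delta -> Phi_star f x y delta = 1.
  by move=> /runs; exact: limn_sup_freq.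
have I0 delta : 0 < delta <= eps -> Phi f x y delta = 0.
  move=> /andP[d0 de]; apply: (@limn_inf_freq R (close_at delta)) => N.
  have [m [n [m0 mn Pmn]]] := far N; exists m, n; split=> // k /Pmn /=.
  rewrite /close_at -!leNgt; exact: le_trans.
have S0 : Phi_star0 f x y = 1.
  apply: lim_near_cst => //; near=> delta; apply: S1.
  by near: delta; exact: nbhs_right_gt.
have P0 : Phi0 f x y = 0.
  apply: lim_near_cst => //; near=> delta; apply: I0; apply/andP; split.
    by near: delta; exact: nbhs_right_gt.
  by near: delta; exact: nbhs_right_le.
have S1' delta : 0 < delta <= diam X -> Phi_star f x y delta = 1.
  by move=> /andP[/S1].
case: i => /=.
- by split=> //; exists eps; rewrite ?e0 // I0 // e0 lexx.
- by [].
- by split=> //; exists eps; rewrite ?e0 // I0 ?ltr01 // e0 lexx.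
- by rewrite S0 P0 ltr01.
- exists 0, eps; split=> // delta /andP[d0 de].
  by rewrite S1 // I0 ?ltr01 // d0 ltW.
Unshelve. all: by end_near.
Qed.

(** Frequencies then converge, so that the two distribution functions agree at
    every positive distance. *)
Lemma not_DC_pair (i : dc_index) : 0 < diam X ->
    (forall delta, 0 < delta -> exists (v : bool) (K : nat),
      forall k, (K <= k)%N -> close_at delta k = v) ->
  ~ DC_pair i f x y.
Proof.
move=> X0 ev.
have PS delta : 0 < delta -> Phi f x y delta = Phi_star f x y delta.
  move=> /ev[v [K vK]].
  have /cvg_limn_inf_sup[e1 e2] := @cvg_freq R (close_at delta) v K vK.
  by rewrite /Phi /Phi_star close_freqE e1 e2.
have d1 := PS _ X0.
case: i => /=.
- move=> [S1 [eps /[dup] /S1 + /andP[e0 _]]]; rewrite -PS // => -> /eqP.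
  by rewrite oner_eq0.
- move=> [S1]; suff -> : Phi0 f x y = 1 by apply/eqP; rewrite oner_eq0.
  apply: lim_near_cst => //; near=> delta.
  have d0 : 0 < delta by near: delta; exact: nbhs_right_gt.
  rewrite PS // S1 // d0 /=.
  by near: delta; exact: nbhs_right_le.
- move=> [S1 [eps /[dup] /S1 + /andP[e0 _]]]; rewrite -PS // => ->.
  by rewrite ltxx.
- suff -> : Phi0 f x y = Phi_star0 f x y by rewrite ltxx.
  have PS0 : \forall d \near (0 : R)^'+, Phi f x y d = Phi_star f x y d.
    by near=> d; apply: PS; near: d; exact: nbhs_right_gt.
  have SP0 : \forall d \near (0 : R)^'+, Phi_star f x y d = Phi f x y d.
    by apply: filterS PS0 => d ->.
  congr (get _); apply/funext => l; apply/propext; split=> lim_l.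
    exact: cvg_trans (near_eq_cvg PS0) lim_l.
  exact: cvg_trans (near_eq_cvg SP0) lim_l.
- move=> [a [c [a0 ac _ lt]]].
  have /lt : a < (a + c) / 2 < c by rewrite !midf_lt.
  by rewrite PS ?ltxx // (le_lt_trans a0) // midf_lt.
Unshelve. all: by end_near.
Qed.

End DC_criteria.

(** * A slow sequence lingering at both ends of the unit interval *)

Section wander.
Context {R : realType}.

(** For [2 <= n], the parity of the [j] with
    [2 ^ 2 ^ j <= n < 2 ^ 2 ^ (j+1)]. *)
Definition rising n := odd (trunc_log 2 (trunc_log 2 n)).

Fixpoint wander (n : nat) : R :=
  if n is m.+1 then
    if rising m then Num.min 1 (wander m + 2 / m.+1%:R)
    else Num.max 0 (wander m - 2 / m.+1%:R)
  else 0.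

Let step_ge0 n : 0 <= 2 / n.+1%:R :> R.
Proof. by rewrite divr_ge0. Qed.

Lemma wander_itv n : 0 <= wander n <= 1.
Proof.
elim: n => [|n /andP[w0 w1]] /=; first by rewrite lexx ler01.
move: (2 / n.+1%:R) (step_ge0 n) => d d0; case: ifP => _; apply/andP; split.
- by rewrite le_min ler01 /=; lra.
- by rewrite ge_min lexx.
- by rewrite le_max lexx.
- by rewrite ge_max ler01 /=; lra.
Qed.

Lemma wander_step n : `|wander n.+1 - wander n| <= 2 / n.+1%:R.
Proof.
have /andP[w0 w1] := wander_itv n.
rewrite /=; move: (2 / n.+1%:R) (step_ge0 n) => d d0.
rewrite /Num.min /Num.max ler_norml.
by repeat case: ifPn; rewrite -?leNgt => *; apply/andP; split; lra.
Qed.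

Definition block j := (2 ^ 2 ^ j)%N.

Lemma block_gt0 j : (0 < block j)%N.
Proof. by rewrite expn_gt0. Qed.

Lemma ltn_block j : (j < block j)%N.
Proof. by rewrite (ltn_trans (ltn_expl j (ltnSn 1))) // ltn_expl. Qed.

Lemma block_rising j n : (block j <= n < block j * block j)%N ->
  rising n = odd j.
Proof.
move=> /andP[jn nj]; have n0 : (0 < n)%N := leq_trans (block_gt0 j) jn.
rewrite /rising (@trunc_log_eq 2 j) // trunc_log_max //=.
rewrite ltnNge; apply/negP => jt; move: nj; rewrite ltnNge => /negP; apply.
apply: leq_trans (trunc_logP (ltnSn 1) n0).
by rewrite /block -expnD addnn -mul2n -expnS leq_exp2l.
Qed.

(** The steps taken before time [2 N] are at least [1 / N], so that [N] of them
    suffice to cross the unit interval. *)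
Lemma wander_ramp N i : (forall n, (N <= n < N + i)%N -> rising n) ->
  (i <= N)%N -> i%:R / N%:R <= wander (N + i).
Proof.
elim: i => [|i IHi] up iN; first by rewrite mul0r; case/andP: (wander_itv (N + 0)).
have N0 : (0 < N)%N by exact: leq_trans iN.
rewrite addnS /= up ?leq_addr ?addnS //= le_min ler_pdivrMr ?ltr0n // mul1r.
rewrite ler_nat iN /= -[i.+1%:R]natr1 (mulrDl i%:R) mul1r lerD //.
  apply: IHi => [n /andP[Nn ni]|]; last exact: ltnW.
  by apply: up; rewrite Nn addnS ltnW.
rewrite ler_pdivlMr ?ltr0n // ler_pdivrMl ?ltr0n // -natrM ler_nat.
by rewrite muln2 -addnn -addnS leq_add2l.
Qed.

Lemma wander_slope N i : (forall n, (N <= n < N + i)%N -> ~~ rising n) ->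
  (i <= N)%N -> wander (N + i) <= 1 - i%:R / N%:R.
Proof.
elim: i => [|i IHi] dn iN.
  by rewrite mul0r subr0; case/andP: (wander_itv (N + 0)).
have N0 : (0 < N)%N by exact: leq_trans iN.
rewrite addnS /= (negbTE (dn _ _)) ?leq_addr ?addnS //= ge_max subr_ge0.
rewrite ler_pdivrMr ?ltr0n // mul1r ler_nat iN /=.
rewrite -[i.+1%:R]natr1 (mulrDl i%:R) mul1r opprD addrA.
rewrite lerB //.
  apply: IHi => [n /andP[Nn ni]|]; last exact: ltnW.
  by apply: dn; rewrite Nn addnS ltnW.
rewrite ler_pdivlMr ?ltr0n // ler_pdivrMl ?ltr0n // -natrM ler_nat.
by rewrite muln2 -addnn -addnS leq_add2l.
Qed.

Lemma block_square j : (2 * block j <= block j * block j)%N.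
Proof. by rewrite leq_mul2r -[X in (X <= _)%N](expn1 2) leq_exp2l ?expn_gt0 ?orbT. Qed.

Lemma wander_top j n : odd j -> (2 * block j <= n <= block j * block j)%N ->
  wander n = 1.
Proof.
move=> oj /andP[/subnK <-]; elim: (n - _)%N => [|i IHi].
  move=> _; apply: le_anti; have /andP[_ ->] := wander_itv (0 + 2 * block j).
  rewrite add0n mul2n -addnn /=.
  apply: le_trans (@wander_ramp (block j) (block j) _ (leqnn _)).
    by rewrite divff // pnatr_eq0 -lt0n block_gt0.
  move=> k /andP[jk kj]; rewrite (@block_rising j) // jk.
  by rewrite (leq_trans kj) // addnn -mul2n block_square.
rewrite addSn => lt /=; rewrite (@block_rising j) ?oj.
  by rewrite (IHi (ltnW lt)); apply/min_idPl; rewrite lerDl.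
by rewrite lt andbT mul2n -addnn addnCA leq_addr.
Qed.

Lemma wander_bottom j n : ~~ odd j ->
  (2 * block j <= n <= block j * block j)%N -> wander n = 0.
Proof.
move=> oj /andP[/subnK <-]; elim: (n - _)%N => [|i IHi].
  move=> _; apply: le_anti; have /andP[-> _] := wander_itv (0 + 2 * block j).
  rewrite add0n mul2n -addnn andbT.
  apply: le_trans (@wander_slope (block j) (block j) _ (leqnn _)) _.
    move=> k /andP[jk kj]; rewrite (@block_rising j) // jk.
    by rewrite (leq_trans kj) // addnn -mul2n block_square.
  by rewrite divff ?subrr // pnatr_eq0 -lt0n block_gt0.
rewrite addSn => lt /=; rewrite (@block_rising j) ?(negbTE oj).
  by rewrite (IHi (ltnW lt)); apply/max_idPl; rewrite sub0r oppr_le0.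
by rewrite lt andbT mul2n -addnn addnCA leq_addr.
Qed.

Definition foot (lam : R) n := wander n + lam * n.+1%:R^-1.

Definition height n : R := 3 * n.+1%:R^-1.

(** Two given feet coincide for exactly one value of [lam]. *)
Lemma foot_injective : exists2 lam : R, 0 < lam < 1 & injective (foot lam).
Proof.
pose bad (p : nat * nat) : R :=
  (wander p.2 - wander p.1) / (p.1.+1%:R^-1 - p.2.+1%:R^-1).
have cb : countable (range bad).
  exact: sub_countable (card_image_le _ _) (countableP _).
have [lam lam01 nlam] := uncountable_gap cb (@ltr01 R).
exists lam => // n m; rewrite /foot => e; apply: contrapT => nm; apply: nlam.
exists (n, m) => //; rewrite /bad /=.
have d : n.+1%:R^-1 - m.+1%:R^-1 != 0 :> R.
  by rewrite subr_eq0 (inj_eq invr_inj) eqr_nat eqSS; apply/eqP.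
apply: (mulIf d); rewrite divfK //; move: e.
by move: (n.+1%:R^-1) (m.+1%:R^-1) => u v; lra.
Qed.

Lemma height_gt0 n : 0 < height n.
Proof. by rewrite mulr_gt0 ?invr_gt0 ?ltr0n. Qed.

Lemma height_le m n : (m <= n)%N -> height n <= height m.
Proof.
by move=> mn; rewrite ler_pM2l // lef_pV2 ?posrE ?ltr0n // ler_nat.
Qed.

Lemma height_small (e : R) : 0 < e ->
  exists N, forall n, (N <= n)%N -> height n < e.
Proof.
move=> e0; have e3 : 0 < e / 3 by rewrite divr_gt0.
have [N N0 Ne] := exists_inv_lt e3; exists N => n Nn.
rewrite /height mulrC -ltr_pdivlMr //; apply: le_lt_trans Ne.
by rewrite lef_pV2 ?posrE ?ltr0n // ler_nat ltnW.
Qed.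

Lemma foot_itv lam n : 0 < lam < 1 -> 0 <= foot lam n <= 2.
Proof.
move=> /andP[l0 l1]; have /andP[w0 w1] := wander_itv n.
have i0 : 0 <= n.+1%:R^-1 :> R by rewrite invr_ge0.
have i1 : n.+1%:R^-1 <= 1 :> R by rewrite invf_le1 ?ltr0n // ler1n.
by rewrite /foot; move: (n.+1%:R^-1) i0 i1 => u *; apply/andP; split; nra.
Qed.

Lemma foot_step lam n : 0 < lam < 1 ->
  `|foot lam n.+1 - foot lam n| <= height n.
Proof.
move=> /andP[l0 l1]; have := wander_step n; rewrite /foot /height.
have i0 : 0 <= n.+2%:R^-1 :> R by rewrite invr_ge0.
have i1 : n.+2%:R^-1 <= n.+1%:R^-1 :> R.
  by rewrite lef_pV2 ?posrE ?ltr0n // ler_nat.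
move: (wander n.+1) (wander n) => u v; rewrite !ler_norml => /andP[s1 s2].
by move: (n.+1%:R^-1) (n.+2%:R^-1) i0 i1 s1 s2 => x y *; apply/andP; split; nra.
Qed.

End wander.

(** * The pair and the absence of infinite sets *)

Section example.
Context {R : realType} (lam : R).
Hypothesis lam01 : 0 < lam < 1.
Hypothesis foot_inj : injective (foot lam).

Local Notation b := (foot lam).
Local Notation h := (@height R).
Local Notation X := (comb_space b h).

Let b_itv n : 0 <= b n <= 2 := foot_itv n lam01.
Let h_gt0 n : 0 < h n := height_gt0 n.
Let b_slow n : `|b n.+1 - b n| <= h n. Proof. exact: foot_step. Qed.

Local Notation f := (comb_shift b_itv h_gt0).
Local Notation tip := (tip b_itv h_gt0).
Local Notation settled := (settled b_itv h_gt0).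

Definition origin : X := base b h 0.

Lemma origin_posE : pos origin = (0, 0).
Proof. by rewrite base_posE // lexx ler0n. Qed.

Lemma iter_origin k : iter k f origin = origin.
Proof.
by elim: k => // k; rewrite iterS => ->; apply: shift_base; rewrite ?origin_posE.
Qed.

Lemma dist_tip_origin k :
  mdist (iter k f (tip 0)) (iter k f origin) = b k + h k.
Proof.
have /andP[b0 _] := b_itv k; rewrite iter_origin iter_shift_tip //.
rewrite mdistE tip_posE origin_posE /barb /= !subr0 normr0 addr0 if_same.
by rewrite !ger0_norm // ltW.
Qed.

Lemma tip_origin_close delta : 0 < delta -> long_runs (close_at f (tip 0) origin delta).
Proof.
move=> d0 N; have d4 : 0 < delta / 4 by rewrite divr_gt0.
have [M M0 Md] := exists_inv_lt d4.
(* even, so that the feet go down at the start of the block j *)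
set j := (2 * maxn N M)%N.
have Nj : (maxn N M <= block j)%N.
  by rewrite (leq_trans _ (ltnW (ltn_block j))) // leq_pmull.
exists (2 * block j)%N, (block j * block j)%N; split.
- by rewrite muln_gt0 block_gt0.
- rewrite mulnA leq_mul2r (leq_trans _ (ltnW (ltn_block j))) ?orbT //.
  by rewrite mulnC leq_mul2l leq_maxl.
move=> k jk; rewrite /close_at dist_tip_origin /foot (@wander_bottom R j) ?add0r //.
  rewrite /height -mulrDl; move: lam01 => /andP[l0 l1].
  have k0 : 0 < k.+1%:R^-1 :> R by rewrite invr_gt0 ltr0n.
  have kM : k.+1%:R^-1 <= M%:R^-1 :> R.
    rewrite lef_pV2 ?posrE ?ltr0n // ler_nat; move: jk => /andP[jk _].
    rewrite (leq_trans (leq_maxr N M)) // (leq_trans Nj) // leqW //.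
    by rewrite (leq_trans _ jk) // leq_pmull.
  by move: (k.+1%:R^-1) (M%:R^-1) k0 kM Md => x y *; nra.
by rewrite /j mul2n odd_double.
Qed.

Lemma tip_origin_far : long_runs (predC (close_at f (tip 0) origin 1)).
Proof.
move=> N; (* odd, so that the feet go up at the start of the block j *)
set j := (2 * N).+1.
exists (2 * block j)%N, (block j * block j)%N; split.
- by rewrite muln_gt0 block_gt0.
- by rewrite mulnA leq_mul2r (leq_trans _ (ltnW (ltn_block j))) ?orbT // mulnC leqW.
move=> k jk; rewrite /= /close_at dist_tip_origin /foot (@wander_top R j) //.
  rewrite -leNgt -addrA lerDl addr_ge0 //; last exact: ltW.
  by rewrite mulr_ge0 ?invr_ge0 //; case/andP: lam01 => /ltW.
by rewrite /j /= mul2n odd_double.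
Qed.

(** At time [k], the feet of two tips [i] steps apart are at distance at most
    [i * h k], and the heights themselves tend to 0. *)
Lemma tips_asymptotic m n delta : 0 < delta ->
  exists K, forall k, (K <= k)%N -> close_at f (tip m) (tip n) delta k.
Proof.
wlog mn : m n / (m <= n)%N => [hw|] d0.
  have [/hw/(_ d0)//|/ltnW/hw/(_ d0)[K dK]] := leqP m n; exists K => k /dK.
  by rewrite /close_at metric_sym.
have c0 : 0 < delta / (n + 2)%:R by rewrite divr_gt0 // ltr0n addn2.
have [K hK] := height_small c0; exists K => k Kk.
rewrite /close_at !iter_shift_tip // mdistE !tip_posE // /barb /=.
have drift i : `|b (m + k) - b (m + k + i)| <= i%:R * h (m + k).
  elim: i => [|i IHi]; first by rewrite addn0 subrr normr0 mul0r.
  rewrite (le_trans (ler_distD (b (m + k + i)) _ _)) // addnS -natr1 mulrDl mul1r.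
  rewrite lerD // distrC (le_trans (b_slow _)) // height_le // leq_addr //.
have hk : h (m + k) < delta / (n + 2)%:R by rewrite hK // (leq_trans Kk) // leq_addl.
have hn : h (n + k) <= h (m + k) by rewrite height_le // leq_add2r.
have := drift (n - m)%N; rewrite addnAC subnKC // => dr.
have tail : (if b (m + k) == b (n + k) then `|h (m + k) - h (n + k)|
    else `|h (m + k)| + `|h (n + k)|) <= 2 * h (m + k).
  have hm0 := h_gt0 (m + k); have hn0 := h_gt0 (n + k).
  case: ifP => _; last by rewrite !gtr0_norm //; lra.
  by rewrite ger0_norm ?subr_ge0 //; lra.
apply: le_lt_trans (lerD dr tail) _; rewrite -mulrDl.
move: hk; rewrite ltr_pdivlMr ?ltr0n ?addn2 // => hk; apply: le_lt_trans hk.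
rewrite mulrC ler_pM2l ?h_gt0 // -[2]/(2%:R) -natrD ler_nat.
by rewrite addn2 !ltnS leq_subr.
Qed.

(** [S] consists of points that come to rest and of tips, and neither part can
    have two elements. *)
Lemma example_no_DC (i : dc_index) (S : set X) : DC_set i f S -> finite_set S.
Proof.
move=> DCS; have X0 : 0 < diam X.
  by rewrite (lt_le_trans _ (@comb_diam _ b h _)) // => n; exact: height_le.
have fin (A : set X) : (forall z w, A z -> A w -> z = w) -> finite_set A.
  move=> A1; have [[z Az]|nA] := pselect (exists z, A z).
    by apply: (@sub_finite_set _ _ [set z]) => // w Aw; exact: A1.
  apply: (@sub_finite_set _ _ set0) => // w Aw; by apply: nA; exists w.
apply: (@sub_finite_set _ _ ((S `&` settled) `|` (S `&` range tip))).
  move=> z Sz; have [zs|[n zn]] := fate b_itv foot_inj h_gt0 z; [by left|].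
  by right; split; [exact: Sz|exists n].
rewrite finite_setU; split; apply: fin => z w [Sz +] [Sw +].
- move=> /(settled_stays foot_inj)[K [p zp]].
  move=> /(settled_stays foot_inj)[L [q wq]].
  apply: contrapT => /(DCS _ _ Sz Sw); apply: not_DC_pair => // delta _.
  exists (mdist p q < delta), (maxn K L) => k.
  by rewrite geq_max /close_at => /andP[/zp -> /wq ->].
- move=> [m _ ez] [n _ ew]; apply: contrapT => /(DCS _ _ Sz Sw).
  apply: not_DC_pair => // delta d0; rewrite -ez -ew.
  by have [K KP] := tips_asymptotic m n d0; exists true, K.
Qed.

End example.

Theorem corollary6 (R : realType) (i : dc_index) :
  exists (X : metricType R) (f : X -> X),
    [/\ dendrite X,
        continuous f,
        exists x y : X, DC_pair i f x y
      & ~ exists S : set X, infinite_set S /\ DC_set i f S].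
Proof.
have [lam lam01 foot_inj] := @foot_injective R.
pose b_itv n : 0 <= foot lam n <= 2 := foot_itv n lam01.
exists (comb_space (foot lam) (@height R)), (comb_shift b_itv (@height_gt0 R)); split.
- apply: comb_dendrite; last exact: height_small.
  by move=> n; exact: height_le.
- apply: shift_continuous => // n; [exact: height_le|exact: foot_step].
- exists (tip b_itv (@height_gt0 R) 0), (origin lam).
  apply: (@DC_pair_of_runs _ _ _ _ _ _ 1).
  + rewrite ltr01 (le_trans _ (@comb_diam _ _ _ _)) ?ler1n //.
    by move=> n; exact: height_le.
  + exact: tip_origin_close.
  + exact: tip_origin_far.
- move=> [S [infS DCS]]; apply: infS.
  exact: (example_no_DC foot_inj DCS).
Qed.
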